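(* Let $\mathbb{F}$ be a field and $n\ge 2$. Then the slice rank of $\det_n$ equals $n$. Moreover, any slice rank decomposition $\det_n=\sum_{i=1}^n \alpha_i g_i$ with exactly $n$ summands is equivalent to the Laplace expansion along the first row, i.e. to the decomposition $\det_n=\sum_{j=1}^n x_{1,j}\cdot (-1)^{1+j}\det(X_{1,j})$, where $X=(x_{i,j})$ is the generic $n\times n$ matrix and $X_{1,j}$ is obtained from $X$ by deleting row $1$ and column $j$.
   Context: $\det_n$ is the determinant, viewed as a homogeneous polynomial of degree $n$ in the $n^2$ entries $x_{i,j}$ of an $n\times n$ matrix over $\mathbb{F}$. For a form (homogeneous polynomial) $f$ of degree $d$, a slice rank decomposition of length $r$ is an expression $f=\sum_{i=1}^r \alpha_i g_i$ with $\alpha_i$ linear forms and $g_i$ forms of degree $d-1$; it is denoted $(\vec\alpha,\vec g)$. The slice rank $\mathrm{srk}(f)$ is the minimal such $r$. A preorder $\lesssim$ on slice rank decompositions of $f$ is the transitive closure of the following rules: (1) Linear reduction: if $\beta_1,\dots,\beta_r$ are linear forms with $\alpha_i=\sum_{j=1}^r c_{i,j}\beta_j$ for all $i$, and $h_j=\sum_{i=1}^r c_{i,j}g_i$, then $(\vec\beta,\vec h)\lesssim(\vec\alpha,\vec g)$. (2) Syzygy reduction: if $h_i=g_i-\sum_{j\ne i}q_{i,j}\alpha_j$ where $(q_{i,j})$ is an alternating matrix of forms of degree $d-2$ ($q_{i,i}=0$, $q_{i,j}=-q_{j,i}$), then $(\vec\alpha,\vec h)\lesssim(\vec\alpha,\vec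 g)$. (3) Symmetric reduction: if $A$ is a linear map of the underlying vector space with $f\circ A=f$, then $(\vec\alpha\circ A,\vec g\circ A)\lesssim(\vec\alpha,\vec g)$. Two decompositions are equivalent if each is $\lesssim$ the other. *)

(* Defs.v *)
From Stdlib Require Import Relation_Operators.
From HB Require Import structures.
From mathcomp Require Import all_boot all_order all_fingroup all_algebra.
From mathcomp Require Import mpoly.

Set Implicit Arguments.
Unset Strict Implicit.
Unset Printing Implicit Defensive.

Import GRing.Theory.

Local Open Scope ring_scope.

(* The zero polynomial is a form of every degree. For d < 2 the truncated
   degrees d.-1 and d - 2 below are not meaningful. *)
Record slice_decomposition (F : fieldType) (m d : nat) (f : {mpoly F[m]})
    (r : nat) := SliceDecomposition {
  sd_lin : 'I_r -> {mpoly F[m]};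
  sd_cof : 'I_r -> {mpoly F[m]};
  sd_lin_homog : forall i, sd_lin i \is 1.-homog;
  sd_cof_homog : forall i, sd_cof i \is (d.-1).-homog;
  sd_sum : f = \sum_(i < r) sd_lin i * sd_cof i
}.

Definition is_slice_rank (F : fieldType) (m d : nat) (f : {mpoly F[m]})
    (r : nat) : Prop :=
  inhabited (slice_decomposition d f r) /\
  (forall s : nat, inhabited (slice_decomposition d f s) -> (r <= s)%N).

(* p \o A, for A acting on column vectors: the k-th variable is replaced by
   the k-th coordinate of A *m x. *)
Definition lin_subst (F : fieldType) (m : nat) (A : 'M[F]_m)
    (p : {mpoly F[m]}) : {mpoly F[m]} :=
  p \mPo [tuple \sum_(l < m) A k l *: 'X_l | k < m].

Section Reductions.

Variables (F : fieldType) (m d : nat) (f : {mpoly F[m]}) (r : nat).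
Implicit Types D E : slice_decomposition d f r.

Definition linear_reduction E D : Prop :=
  exists c : 'M[F]_r,
    (forall i, sd_lin D i = \sum_(j < r) c i j *: sd_lin E j) /\
    (forall j, sd_cof E j = \sum_(i < r) c i j *: sd_cof D i).

Definition syzygy_reduction E D : Prop :=
  exists q : 'M[{mpoly F[m]}]_r,
    [/\ forall i j, q i j \is (d - 2).-homog,
        forall i, q i i = 0,
        forall i j, q i j = - q j i,
        forall i, sd_lin E i = sd_lin D i
      & forall i,
          sd_cof E i = sd_cof D i - \sum_(j < r | j != i) q i j * sd_lin D j].

Definition symmetric_reduction E D : Prop :=
  exists A : 'M[F]_m,
    [/\ lin_subst A f = f,
        forall i, sd_lin E i = lin_subst A (sd_lin D i)
      & forall i, sd_cof E i = lin_subst A (sd_cof D i)].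

Definition reduction_step E D : Prop :=
  [\/ linear_reduction E D, syzygy_reduction E D | symmetric_reduction E D].

(* Reflexive as well, by linear reduction along the identity matrix. *)
Definition sd_le E D : Prop := clos_trans _ reduction_step E D.

Definition sd_equiv D E : Prop := sd_le D E /\ sd_le E D.

End Reductions.

Section Determinant.

Variables (F : fieldType) (n : nat).

Definition generic_mx : 'M[{mpoly F[n * n]}]_n :=
  \matrix_(i, j) 'X_(mxvec_index i j).

Definition det_form : {mpoly F[n * n]} := \det generic_mx.

Lemma dhomog_prod_ord (m k : nat) (p : 'I_k -> {mpoly F[m]}) :
  (forall i, p i \is 1.-homog) -> \prod_(i < k) p i \is k.-homog.
Proof.
elim: k p => [|k IHk] p hp; first by rewrite big_ord0; exact: dhomog1.
rewrite big_ord_recl; apply: (dhomogM (hp ord0)).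
by apply: IHk => i; apply: hp.
Qed.

Lemma dhomog_det (m k : nat) (M : 'M[{mpoly F[m]}]_k) :
  (forall i j, M i j \is 1.-homog) -> \det M \is k.-homog.
Proof.
move=> hM; apply: rpred_sum => s _; rewrite -signr_odd mulr_sign.
have h : \prod_i M i (s i) \is k.-homog by apply: dhomog_prod_ord.
by case: ifP => _ //; rewrite rpredN.
Qed.

Lemma generic_mx_homog i j : generic_mx i j \is 1.-homog.
Proof. by rewrite mxE dhomogX; apply/eqP; exact: mdeg1. Qed.

Lemma cofactor_generic_homog i j :
  cofactor generic_mx i j \is (n.-1).-homog.
Proof.
have h : \det (row' i (col' j generic_mx)) \is (n.-1).-homog.
  by apply: dhomog_det => a b; rewrite !mxE dhomogX; apply/eqP; exact: mdeg1.
by rewrite /cofactor -signr_odd mulr_sign; case: ifP => _ //; rewrite rpredN.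
Qed.

(* Indices start at 0; the sign (-1) ^+ (i + j) in [cofactor] is unaffected. *)
Definition laplace_decomposition (i : 'I_n) :
    slice_decomposition n det_form n :=
  SliceDecomposition (generic_mx_homog i) (cofactor_generic_homog i)
    (expand_det_row generic_mx i).

End Determinant.

(* Main.v *)
Require Import Defs.
From Stdlib Require Import Relation_Operators.
From HB Require Import structures.
From mathcomp Require Import all_boot all_order all_fingroup all_algebra.
From mathcomp Require Import mpoly.
From mathcomp Require Import zify.

(* The common zeros of the linear forms of a decomposition of length r form a
   space W of n x n matrices, of codimension at most r, on which det vanishes
   identically. By Dieudonne's theorem such a W has codimension at least n, and
   when the codimension is n, W is {A | u A = 0} or {A | A v = 0}. Transposition
   exchanges the two types and a substitution X -> Q X with det Q = 1 turns u
   into a basis vector; then the linear forms are, up to an invertible change of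
   basis, the variables of a row of X, and two decompositions with these linear
   forms differ by a syzygy of distinct variables, which is a Koszul one.

   For Dieudonne's theorem, order the rows and let V_i be the space of the i-th
   rows of those A in W whose later rows vanish, so that the dimensions of the
   V_i add up to dim W. Linearly independent a_i in V_i would give a nonzero
   coefficient of det on W; counting dimensions, either some V_i is 0 or all V_i
   are the same hyperplane. In the first case the i-th row of A in W is a linear
   function of the others, and the vanishing of det makes it a fixed linear
   combination of them. In the second, comparing with the order in which the
   i-th row comes last shows that all rows of W lie in that hyperplane. *)

Set Implicit Arguments.
Unset Strict Implicit.
Unset Printing Implicit Defensive.

Import GRing.Theory.

Local Open Scope ring_scope.

(** * Spaces of singular matrices *)

Section SingularSpaces.
Variables (F : fieldType) (n : nat).
Implicit Types W : {vspace 'M[F]_n}.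

(* det vanishes on W as a polynomial; over a finite field this says more than
   that every matrix of W is singular. *)
Definition poly_singular W := forall A : 'M[{poly F}]_n,
  (forall d, map_mx (coefp d) A \in W) -> \det A = 0.

(* In the sum of the X^(e i) A_i, row j is divisible by X^(e j): divide the
   determinant by these powers and set X = 0. *)
Lemma staircase W (A : 'I_n -> 'M[F]_n) (e : 'I_n -> nat) :
    poly_singular W -> (forall i, A i \in W) ->
    (forall i j, (e i < e j)%N -> row j (A i) = 0) ->
  \det (\matrix_j \sum_(i | e i == e j) row j (A i)) = 0.
Proof.
move=> singW AW Ae.
pose M : 'M[{poly F}]_n := \matrix_(j, k) \sum_i (A i j k)%:P * 'X^(e i).
pose N : 'M[{poly F}]_n :=
  \matrix_(j, k) \sum_(i | (e j <= e i)%N) (A i j k)%:P * 'X^(e i - e j).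
have detM : \det M = 0.
  apply: singW => d.
  suff -> : map_mx (coefp d) M = \sum_(i | e i == d) A i.
    by apply: memv_suml => i _; exact: AW.
  apply/matrixP=> j k; rewrite !mxE summxE /coefp coef_sum [RHS]big_mkcond /=.
  apply: eq_bigr => i _; rewrite coefCM coefXn eq_sym.
  by case: eqP => _; rewrite ?mulr1 ?mulr0.
have MN : M = diag_mx (\row_j 'X^(e j)) *m N.
  apply/matrixP=> j k; rewrite mul_diag_mx !mxE big_distrr /=.
  rewrite [RHS]big_mkcond; apply: eq_bigr => i _.
  case: leqP => [le_ji|lt_ij]; first by rewrite mulrCA -exprD subnKC.
  by have /rowP/(_ k) := Ae _ _ lt_ij; rewrite !mxE => ->; rewrite mul0r.
have detN : \det N = 0.
  move/eqP: detM; rewrite MN det_mulmx det_diag mulf_eq0 => /orP[|/eqP//].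
  rewrite prodf_seq_eq0 => /hasP[j _] /=.
  by rewrite mxE expf_eq0 polyX_eq0 andbF.
have := congr1 (horner_eval 0) detN; rewrite rmorph0 -det_map_mx => <-.
congr (\det _); apply/matrixP=> j k; rewrite !mxE summxE rmorph_sum /=.
rewrite [LHS]big_mkcond [RHS]big_mkcond; apply: eq_bigr => i _.
rewrite /horner_eval !hornerE expr0n subn_eq0 [e i == _]eqn_leq andbC.
by case: (e j <= e i)%N => //=; case: (_ <= _)%N; rewrite ?mxE ?mulr1 ?mulr0.
Qed.

(** The choice runs from the end of [s]. When [i] is reached, the vectors chosen for [t] together
    with [X] span at most [size t + size X] dimensions, so [V i] contains a vector outside their
    span. *)
Lemma greedy_transversal (I : eqType) (V : I -> {vspace 'rV[F]_n}) (X : seq 'rV[F]_n)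
    (s : seq I) :
    uniq s -> free X ->
    (forall i t, suffix (i :: t) s -> (size t + size X < \dim (V i))%N) ->
  exists a : I -> 'rV[F]_n,
    {in s, forall i, a i \in V i} /\ free ([seq a i | i <- s] ++ X).
Proof.
move=> + X_free; elim: s => [_ _|i s IHs /= /andP[i_s s_uniq] dimV].
  by exists (fun=> 0).
have [|a [aV a_free]] := IHs s_uniq.
  move=> j t st; apply: dimV; exact: suffix_trans st (suffix_cons _ _).
have : ~~ (V i <= <<[seq a i | i <- s] ++ X>>)%VS.
  apply/negP=> /dimvS; rewrite leqNgt => /negP; apply.
  apply: leq_ltn_trans (dim_span _) _; rewrite size_cat size_map.
  by apply: dimV; rewrite suffix_refl.
case/subvPn=> b bV b_a; exists (fun j => if j == i then b else a j); split.
  move=> j; rewrite inE; case: eqP => [-> _|_ /= js] //; exact: aV.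
rewrite /= eqxx.
have -> : [seq if j == i then b else a j | j <- s] = [seq a j | j <- s].
  by apply/eq_in_map=> j js; case: eqP => // ji; rewrite -ji js in i_s.
by rewrite free_cons b_a.
Qed.

Lemma det_free_rows (a : 'I_n -> 'rV[F]_n) (s : seq 'I_n) :
  perm_eq s (enum 'I_n) -> free [seq a i | i <- s] -> \det (\matrix_i a i) != 0.
Proof.
move=> s_enum; rewrite (perm_free (perm_map a s_enum)) => a_free.
apply/det0P=> -[u u0]; rewrite mulmx_sum_row => sum0.
case/negP: u0; apply/eqP/rowP=> i; rewrite mxE.
have sz : size [seq a i | i <- enum 'I_n] == n by rewrite size_map size_enum_ord.
have /freeP/(_ (u 0)) -> // : free (Tuple sz) by [].
rewrite -[RHS]sum0; apply: eq_bigr => j _.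
by rewrite rowK /= (nth_map j) ?size_enum_ord // nth_ord_enum.
Qed.

(** Fix [b] in [V j] outside [V i], choose greedily for the other indices, and treat [i] last. The
    [n.-1] vectors chosen before cannot span a space containing [V i]: by dimension it would equal
    [V i], yet it contains [b]. *)
Lemma equal_or_transversal (V : 'I_n -> {vspace 'rV[F]_n}) (i j : 'I_n) :
    (forall k, \dim (V k) = n.-1) -> V j != V i ->
  exists a, (forall k, a k \in V k) /\ \det (\matrix_k a k) != 0.
Proof.
move=> dimV Vij.
have n_gt0 : (0 < n)%N by apply: leq_ltn_trans (ltn_ord i).
have ij : j != i by apply: contraNneq Vij => ->.
have : ~~ (V j <= V i)%VS by apply: contraNN Vij => ?; rewrite eqEdim !dimV leqnn andbT.
case/subvPn=> b bVj bVi.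
have b0 : b != 0 by apply: contraNneq bVi => ->; exact: mem0v.
pose s := [seq k <- enum 'I_n | (k != i) && (k != j)].
have mem_s k : (k \in s) = (k != i) && (k != j) by rewrite mem_filter mem_enum andbT.
have s_uniq : uniq s by rewrite filter_uniq ?enum_uniq.
have is_enum : perm_eq (i :: rcons s j) (enum 'I_n).
  apply: uniq_perm; rewrite ?enum_uniq //=.
    by rewrite mem_rcons inE rcons_uniq !mem_s !eqxx andbF orbF eq_sym ij s_uniq.
  move=> k; rewrite inE mem_rcons inE mem_s mem_enum.
  by case: (k == i); case: (k == j).
have sz_s : (size s).+2 = n.
  by rewrite -[RHS]size_enum_ord -(perm_size is_enum) /= size_rcons.
have n1 : (size s).+1 = n.-1 := congr1 predn sz_s.
have [||a [aV a_free]] := @greedy_transversal _ V [:: b] s s_uniq.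
- by rewrite seq1_free.
- by move=> k t /size_suffix ts; rewrite dimV addn1 -n1 ltnS.
have : ~~ (V i <= <<[seq a k | k <- s] ++ [:: b]>>)%VS.
  apply: contra bVi => Vi.
  suff /eqP-> : V i == <<[seq a k | k <- s] ++ [:: b]>>%VS.
    by rewrite memv_span // mem_cat inE eqxx orbT.
  rewrite eqEdim Vi (leq_trans (dim_span _)) // size_cat size_map dimV.
  by rewrite addn1 n1.
case/subvPn=> c cV c_a.
exists (fun k => if k == i then c else if k == j then b else a k); split.
  move=> k; case: eqP => [->//|/eqP ki]; case: eqP => [->//|/eqP kj].
  by apply: aV; rewrite mem_s ki.
apply: (det_free_rows is_enum); rewrite /= eqxx map_rcons (negPf ij) eqxx -cats1.
set a' := map _ s; have -> : a' = [seq a k | k <- s].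
  by apply/eq_in_map=> k; rewrite mem_s => /andP[/negPf-> /negPf->].
by rewrite free_cons c_a.
Qed.

(** Sort the spaces by decreasing dimension and choose greedily from the smallest one up. This can
    fail only if the space at some position [k], counted from 0, has dimension at most [n - k.+1].
    The sum of the dimensions is then at most [k * n + (n - k) * (n - k.+1)], which forces [k = 0]
    or [k = n.-1]. *)
Lemma transversal_trichotomy (V : 'I_n -> {vspace 'rV[F]_n}) :
    (n * n.-1 <= \sum_i \dim (V i))%N ->
  [\/ exists a, (forall i, a i \in V i) /\ \det (\matrix_i a i) != 0,
      exists i, V i = 0%VS
    | exists H, \dim H = n.-1 /\ forall i, V i = H].
Proof.
move=> sumV.
case: (posnP n) => [n0|n_gt0].
  apply: Or31; exists (fun=> 0); split=> [i|]; first by exfalso; case: i => i; rewrite n0.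
  apply/det0P=> -[u /eqP[]]; apply/rowP=> i; exfalso; case: i => i; by rewrite n0.
pose i0 := Ordinal n_gt0.
pose le_dim i j := (\dim (V j) <= \dim (V i))%N.
have le_total : total le_dim by move=> i j; exact: leq_total.
have le_trans : transitive le_dim by move=> j i k ij jk; exact: leq_trans jk ij.
pose s := sort le_dim (enum 'I_n).
have s_enum : perm_eq s (enum 'I_n) by rewrite perm_sort.
have s_sorted : sorted le_dim s by apply: sort_sorted.
have sz_s : size s = n by rewrite size_sort size_enum_ord.
have s_anti k l : (k <= l < n)%N -> (\dim (V (nth i0 s l)) <= \dim (V (nth i0 s k)))%N.
  case/andP=> kl ln; apply: (sorted_leq_nth le_trans (fun i => leqnn _) i0 s_sorted) => //.
    by rewrite inE sz_s (leq_ltn_trans kl).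
  by rewrite inE sz_s.
have sum_s : (\sum_i \dim (V i) = \sum_(k < n) \dim (V (nth i0 s k)))%N.
  by rewrite -big_enum -(perm_big _ s_enum) (big_nth i0) sz_s big_mkord.
have [/forallP good|] := boolP [forall k : 'I_n, (n - k.+1 < \dim (V (nth i0 s k)))%N].
  have [||i t|a [aV a_free]] := @greedy_transversal _ V [::] s.
  - by rewrite sort_uniq enum_uniq.
  - exact: nil_free.
  - case/suffixP=> p sp; rewrite addn0.
    have sz : (size p + (size t).+1)%N = n by move: sz_s; rewrite sp size_cat.
    have pn : (size p < n)%N by lia.
    have := good (Ordinal pn); rewrite /= sp nth_cat ltnn subnn /=; apply: leq_ltn_trans.
    by move/(congr1 (subn^~ (size p).+1)): sz; rewrite addnS -addSn addKn => <-.
  apply: Or31; exists a; split; first by move=> i; apply: aV; rewrite mem_sort mem_enum.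
  by apply: (det_free_rows s_enum); rewrite cats0 in a_free.
rewrite negb_forall => /existsP[k]; rewrite -leqNgt => dim_k.
have dim_le (l : 'I_n) : (\dim (V (nth i0 s l)) <= if (l < k)%N then n else n - k.+1)%N.
  case: ltnP => [_|kl]; last by apply: leq_trans dim_k; apply: s_anti; rewrite kl /=.
  by rewrite (leq_trans (dimvS (subvf _))) // dimvf /dim /= mul1n.
have sum_le : (\sum_i \dim (V i) <= k * n + (n - k) * (n - k.+1))%N.
  rewrite sum_s; apply: leq_trans (leq_sum _ (fun l _ => dim_le l)) _.
  rewrite -(big_mkord predT (fun l => if (l < k)%N then n else (n - k.+1)%N)).
  rewrite (big_cat_nat (n := k)) ?(ltnW (ltn_ord k)) //=.
  rewrite (eq_big_nat _ _ (F2 := fun=> n)); last by move=> l /andP[_ ->].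
  rewrite [X in (_ + X)%N](eq_big_nat _ _ (F2 := fun=> (n - k.+1)%N)).
    by rewrite !sum_nat_const_nat subn0.
  by move=> l /andP[kl _]; rewrite ltnNge kl.
(* For [k = 0] every dimension is at most [n.-1], and the lower bound on the sum makes all of them
   equal to [n.-1]. *)
have [k0|k_gt0] := posnP k.
  have dimV i : (\dim (V i) <= n.-1)%N.
    have i_s : i \in s by rewrite mem_sort mem_enum.
    have i_n : (index i s < n)%N by move: i_s; rewrite -index_mem sz_s.
    by have := dim_le (Ordinal i_n); rewrite /= k0 nth_index // subn1.
  have dimE i : \dim (V i) = n.-1.
    apply/eqP; rewrite eqn_leq dimV leqNgt; apply/negP=> lt_i.
    have sum_le' : (\sum_j \dim (V j) <= \dim (V i) + n.-1 * n.-1)%N.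
      rewrite (bigD1 i) //= leq_add2l; apply: leq_trans (leq_sum _ (fun j _ => dimV j)) _.
      by rewrite sum_nat_const cardC1 card_ord.
    have := leq_trans sumV sum_le'; rewrite -{1}(prednK n_gt0) mulSn leq_add2r.
    by rewrite leqNgt lt_i.
  have [/forallP eqV|] := boolP [forall i, V i == V i0].
    by apply: Or33; exists (V i0); split=> // i; apply/eqP.
  rewrite negb_forall => /existsP[j Vj]; apply: Or31.
  exact: equal_or_transversal dimE Vj.
apply: Or32; exists (nth i0 s k); apply/eqP; rewrite -dimv_eq0 -leqn0.
apply: leq_trans dim_k _; rewrite leqn0 subn_eq0.
have := leq_trans sumV sum_le; have := ltn_ord k; move: k_gt0.
move: (nat_of_ord k) => l l_gt0 ln.
(* In terms of [l] and [c] the two bounds on the sum give [l * c <= 0], hence [c = 0]: the space is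
   the last one and it is 0. *)
have [c ->] : exists c, n = (l + c.+1)%N by exists (n - l.+1)%N; lia.
rewrite addKn addnS /= subSS addKn; nia.
Qed.

(** * Row flags and Dieudonne's theorem *)

Definition rowlf (i : 'I_n) : 'Hom('M[F]_n, 'rV[F]_n) := linfun (row i).

Lemma rowlfE i A : rowlf i A = row i A. Proof. by rewrite lfunE. Qed.

(** The permutation encodes an order of the rows, [s j] being the position of row [j]. The flag
    grows from 0 at [m = 0] to [W] at [m = n]. *)
Definition row_flag W (s : 'S_n) m : {vspace 'M[F]_n} :=
  (W :&: \bigcap_(j | (m <= s j)%N) lker (rowlf j))%VS.

Lemma mem_row_flag W (s : 'S_n) m A :
  reflect (A \in W /\ forall j, (m <= s j)%N -> row j A = 0) (A \in row_flag W s m).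
Proof.
apply: (iffP memv_capP) => -[AW Arow]; split=> //.
  move=> j mj; apply/eqP; rewrite -rowlfE -memv_ker.
  by rewrite memvE; move: Arow; rewrite memvE => /subv_bigcapP; apply.
by rewrite memvE; apply/subv_bigcapP => j mj; rewrite -memvE memv_ker rowlfE Arow.
Qed.

(** These are the spaces V_i of Dieudonne's argument for the row order [s]. *)
Definition row_layer W (s : 'S_n) i : {vspace 'rV[F]_n} :=
  (rowlf i @: row_flag W s (s i).+1)%VS.

(** On the flag at [(s i).+1], the kernel of taking row [i] is the flag at [s i]; the rank formula
    then telescopes along the flag. *)
Lemma sum_row_layer W (s : 'S_n) : (\sum_i \dim (row_layer W s i) = \dim W)%N.
Proof.
have flagS i : (row_flag W s (s i).+1 :&: lker (rowlf i))%VS = row_flag W s (s i).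
  apply/vspaceP=> A; apply/memv_capP/mem_row_flag => [[/mem_row_flag[AW Arow]]|[AW Arow]].
    rewrite memv_ker rowlfE => /eqP Ai; split=> // j.
    by rewrite leq_eqVlt => /orP[/eqP/ord_inj/perm_inj<-|/Arow].
  rewrite memv_ker rowlfE Arow //; split=> //; apply/mem_row_flag; split=> // j ij.
  by apply: Arow; exact: ltnW.
have flag_dim m : (m <= n)%N ->
    (\sum_(i < n | (s i < m)%N) \dim (row_layer W s i) = \dim (row_flag W s m))%N.
  elim: m => [_|m IHm mn].
    rewrite big_pred0 //; apply/esym/eqP; rewrite dimv_eq0 -subv0.
    apply/subvP=> A /mem_row_flag[_ Arow]; rewrite memv0; apply/eqP/row_matrixP=> j.
    by rewrite Arow ?row0.
  pose i := (s^-1)%g (Ordinal mn); have si : s i = Ordinal mn by rewrite permKV.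
  rewrite (bigD1 i) /= ?si // -(limg_ker_dim (rowlf i)).
  have := flagS i; rewrite /row_layer si /= => ->; rewrite addnC -IHm 1?ltnW //.
  congr (_ + _)%N; apply: eq_bigl => j; rewrite ltnS [in RHS]ltn_neqAle andbC.
  congr (_ && _); apply/idP/idP; apply: contra => /eqP.
    by move=> sj; apply/eqP/(@perm_inj _ s)/ord_inj; rewrite si.
  by move=> ->; rewrite si.
have <- : (\sum_(i < n | (s i < n)%N) \dim (row_layer W s i) = \dim W)%N.
  rewrite flag_dim //; congr (\dim _); apply/vspaceP=> A.
  by apply/mem_row_flag/idP=> [[]//|AW]; split=> // j; rewrite leqNgt ltn_ord.
by apply: eq_bigl => i; rewrite ltn_ord.
Qed.

(** A transversal of the layers lifts to matrices of [W], to which [staircase] applies with the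
    exponents [s i]. These are distinct, so each sum there has a single term and the determinant of
    the transversal vanishes. *)
Lemma row_layer_dichotomy W (s : 'S_n) :
    poly_singular W -> (n * n.-1 <= \dim W)%N ->
  (exists i, forall A, A \in W -> (forall j, j != i -> row j A = 0) -> A = 0) \/
  (exists H, \dim H = n.-1 /\ forall i, row_layer W s i = H).
Proof.
move=> singW; rewrite -(sum_row_layer W s) => /transversal_trichotomy[].
- case=> a [aV /negP[]]; apply/eqP.
  have /fin_all_exists[A AE] i : exists A, A \in row_flag W s (s i).+1 /\ row i A = a i.
    by have /memv_imgP[A AW aE] := aV i; exists A; rewrite aE rowlfE.
  have Aflag i : A i \in W /\ forall j, (s i < s j)%N -> row j (A i) = 0.
    by have [/mem_row_flag] := AE i.
  rewrite -[RHS](@staircase W A (fun i => s i) singW) => [|i|i j].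
  + congr (\det _); apply/row_matrixP=> j; rewrite !rowK (big_pred1 j) => [|i].
      by have [_ ->] := AE j.
    by rewrite /= -[s i == s j :> nat]/(s i == s j) (inj_eq perm_inj).
  + by have [] := Aflag i.
  + by have [_] := Aflag i; apply.
- case=> i Vi; left; exists i => A AW Arow.
  apply/row_matrixP=> j; rewrite row0; have [->|/Arow//] := eqVneq j i.
  have : row i A \in row_layer W s i.
    rewrite -rowlfE memv_img //; apply/mem_row_flag; split=> // k ik.
    by apply: Arow; apply: contraTneq ik => ->; rewrite ltnn.
  by rewrite Vi memv0 => /eqP.
- by right.
Qed.

(** Row [i] is a linear function of the other rows, and by dimension these are arbitrary ([extend]).
    If only rows [i] and [k] are nonzero, row [i] is a multiple of row [k] ([row_line]), by a factor
    depending only on [k] ([row_scal]); the general case is a sum of such matrices. *)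
Lemma row_type W (i : 'I_n) :
    poly_singular W -> (n * n.-1 <= \dim W)%N ->
    (forall A, A \in W -> (forall j, j != i -> row j A = 0) -> A = 0) ->
  exists2 u : 'rV[F]_n, u != 0 & forall A, A \in W -> u *m A = 0.
Proof.
move=> singW dimW injW.
have n_gt0 : (0 < n)%N by apply: leq_ltn_trans (ltn_ord i).
have extend (B : 'M[F]_n) : exists A, A \in W /\ forall j, j != i -> row j A = row j B.
  have nn : (n * n = n * n.-1 + n)%N by rewrite -{2}(prednK n_gt0) mulnS addnC.
  (* [L] clears row [i]. It is injective on [W], so [L] maps [W] onto all matrices with zero row
     [i]. *)
  pose L : 'Hom('M[F]_n, 'M[F]_n) := linfun (mulmx (1%:M - delta_mx i i)).
  have LE A j : row j (L A) = if j == i then 0 else row j A.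
    rewrite lfunE /= mulmxBl mul1mx raddfB /= row_mul rowE mul_delta_mx_cond.
    rewrite eq_sym; case: eqP => [->|_]; last by rewrite mul0mx subr0.
    by rewrite mulr1n -rowE subrr.
  have dimZ : \dim (lker (rowlf i)) = (n * n.-1)%N.
    have := limg_ker_dim (rowlf i) fullv; rewrite capfv.
    have -> : (rowlf i @: fullv)%VS = fullv.
      apply/vspaceP=> a; rewrite memvf; apply/memv_imgP.
      exists (\matrix_j a); rewrite ?memvf // rowlfE rowK //.
    by rewrite !dimvf /dim /= mul1n nn => /addIn.
  have LW : (L @: W)%VS = lker (rowlf i).
    apply/eqP; rewrite eqEdim; apply/andP; split.
      apply/subvP=> _ /memv_imgP[A AW ->].
      by rewrite memv_ker rowlfE LE eqxx.
    rewrite dimZ limg_dim_eq //; apply/eqP; rewrite -subv0.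
    apply/subvP=> A /memv_capP[AW]; rewrite memv_ker memv0 => /eqP LA.
    apply/eqP/injW=> // j /negPf ji; have := LE A j; rewrite ji => <-.
    by rewrite LA row0.
  have : L B \in (L @: W)%VS by rewrite LW memv_ker rowlfE LE eqxx.
  case/memv_imgP=> A AW LBA; exists A; split=> // j /negPf ji.
  by have := LE A j; have := LE B j; rewrite ji => <- <-; rewrite LBA.
have row_line k A : k != i -> A \in W -> (forall j, j != i -> j != k -> row j A = 0) ->
    row i A \in <[row k A]>%VS.
  move=> ki AW Arow; apply: contraT => Ai.
  have Ak : row k A != 0.
    apply: contraNneq Ai => Ak; rewrite (injW A) ?row0 ?mem0v // => j ji.
    by have [->|/Arow->] := eqVneq j k.
  (* If rows [i] and [k] of [A] were independent, vectors [b j] for [j] in [t] would complete them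
     to a basis; [staircase] is applied to contradict this. *)
  pose t := [seq j <- enum 'I_n | (j != i) && (j != k)].
  have t_uniq : uniq t by rewrite filter_uniq ?enum_uniq.
  have mem_t j : (j \in t) = (j != i) && (j != k) by rewrite mem_filter mem_enum andbT.
  have t_enum : perm_eq (t ++ [:: i; k]) (enum 'I_n).
    apply: uniq_perm; rewrite ?enum_uniq //.
      rewrite cat_uniq t_uniq; apply/and3P; split=> //; last by rewrite /= inE eq_sym ki.
      by apply/hasPn=> j; rewrite !inE mem_t => /orP[]/eqP->; rewrite eqxx ?andbF.
    move=> j; rewrite mem_cat mem_t !inE mem_enum.
    by case: (j == i); case: (j == k).
  have sz_t : (size t + 2 = n)%N by rewrite -[RHS]size_enum_ord -(perm_size t_enum) size_cat.
  have [||b [_ b_free]] :=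
    @greedy_transversal _ (fun=> fullv) [:: row i A; row k A] t t_uniq.
  - by rewrite free_cons span_seq1 Ai seq1_free.
  - move=> j t' /size_suffix t't; rewrite dimvf /dim /= mul1n.
    by rewrite -[X in (_ < X)%N]sz_t ltn_add2r.
  have /fin_all_exists[E EE] l : exists E, E \in W /\
      forall j, j != i -> row j E = if j == l then b l else 0.
    have [E [EW Erow]] := extend (\matrix_j if j == l then b l else 0).
    by exists E; split=> // j /Erow->; rewrite rowK.
  (* The exponent is 1 on [t] and 0 at [i] and [k]. Row [i] of [E l] is not controlled, but it comes
     with a factor X and disappears at X = 0; what remains are the rows [b j] and the rows [i], [k]
     of [A]. *)
  pose A' l := if l == i then 0 else if l == k then A else E l.
  have : \det (\matrix_j (if j \in t then b j else row j A)) != 0.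
    apply: (det_free_rows t_enum); rewrite map_cat /= !mem_t !eqxx ki /=.
    set t' := map _ t; suff -> : t' = [seq b j | j <- t] by [].
    by apply/eq_in_map=> j ->.
  have rowA' l j : l \in t -> j != i -> row j (A' l) = if j == l then b l else 0.
    by rewrite mem_t /A' => /andP[/negPf-> /negPf->] /(EE l).2.
  have A'i : A' i = 0 by rewrite /A' eqxx.
  have A'k : A' k = A by rewrite /A' (negPf ki) eqxx.
  have notin_t l : l \notin t -> l = i \/ l = k.
    by rewrite mem_t negb_and !negbK => /orP[]/eqP->; [left | right].
  apply: contraNT => _; apply/eqP.
  rewrite -[RHS](@staircase W A' (fun j => j \in t) singW) => [|j|l j].
  - congr (\det _); apply/row_matrixP=> j; rewrite !rowK; case: ifP => jt.
      have ji : j != i by move: jt; rewrite mem_t => /andP[].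
      rewrite (bigD1 j) ?jt //= big1 => [|l]; first by rewrite addr0 rowA' // eqxx.
      by rewrite eqb1 => /andP[lt lj]; rewrite rowA' // eq_sym (negPf lj).
    rewrite (bigD1 k) ?mem_t ?eqxx ?andbF //= A'k big1 ?addr0 // => l.
    rewrite eqb0 => /andP[/notin_t[->|->]]; last by rewrite eqxx.
    by rewrite A'i row0.
  - rewrite /A'; case: (j == i); first exact: mem0v.
    by case: (j == k) => //; exact: (EE _).1.
  - case: (boolP (j \in t)) => jt; case: (boolP (l \in t)) => // /notin_t[->|->] _.
      by rewrite A'i row0.
    by move: jt; rewrite mem_t A'k => /andP[]; exact: Arow.
have row_scal k : exists c, k != i -> forall A, A \in W ->
    (forall j, j != i -> j != k -> row j A = 0) -> row i A = c *: row k A.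
  have [->|ki] := eqVneq k i; first by exists 0.
  have /fin_all_exists[E EE] j : exists E, E \in W /\
      forall l, l != i -> row l E = if l == k then delta_mx 0 j else 0.
    have [E [EW Erow]] := extend (delta_mx k j).
    exists E; split=> // l /Erow->; rewrite rowE mul_delta_mx_cond eq_sym.
    by case: eqP.
  have Ek j : row k (E j) = delta_mx 0 j by rewrite (EE j).2 ?eqxx.
  have Erow j l : l != i -> l != k -> row l (E j) = 0.
    by move=> li /negPf lk; rewrite (EE j).2 // lk.
  have /fin_all_exists[c cE] j : exists c, row i (E j) = c *: delta_mx 0 j.
    by have /vlineP[c] := row_line k _ ki (EE j).1 (Erow j); exists c; rewrite -Ek.
  (* Here [i] serves as a reference column. Row [k] of [E j + E i] has 1 in both columns, so
     proportionality of row [i] to it equates the two factors. *)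
  have c_const j : c j = c i.
    have [->//|ji] := eqVneq j i.
    have := row_line k (E j + E i) ki (memvD (EE j).1 (EE i).1) _.
    case/(_ _)/vlineP=> [l li lk|d]; first by rewrite raddfD /= !Erow ?addr0.
    rewrite !raddfD /= !cE !Ek => /rowP eq_d.
    have := eq_d j; have := eq_d i.
    rewrite !mxE !eqxx /= eq_sym (negPf ji) /=.
    by rewrite !mulr0 !mulr1 !add0r !addr0 => -> ->.
  exists (c i) => _ A AW Arow.
  have -> : A = \sum_j A k j *: E j.
    apply/eqP; rewrite -subr_eq0; apply/eqP/injW.
      by rewrite memvB // memv_suml // => j _; rewrite memvZ ?(EE j).1.
    move=> l li; rewrite raddfB raddf_sum /=.
    have [->|lk] := eqVneq l k.
      rewrite [X in X - _]row_sum_delta; apply/eqP; rewrite subr_eq0; apply/eqP.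
      by apply: eq_bigr => j _; rewrite mxE linearZ /= Ek.
    rewrite Arow // sub0r big1 ?oppr0 // => j _.
    by rewrite linearZ /= Erow ?scaler0.
  rewrite !raddf_sum /=; apply: eq_bigr => j _.
  by rewrite !linearZ /= cE Ek c_const !scalerA mulrC.
have /fin_all_exists[c cE] := row_scal.
exists (\row_k if k == i then 1 else - c k).
  by apply/eqP => /rowP/(_ i); rewrite !mxE eqxx => /eqP; rewrite oner_eq0.
move=> A AW.
(* [A] is the sum of the matrices of [W] that keep only one row of [A] besides row [i]; [row_scal]
   applies to each. *)
have /fin_all_exists[E EE] k : exists E, E \in W /\
    forall j, j != i -> row j E = if j == k then row k A else 0.
  have [E [EW Erow]] := extend (\matrix_j if j == k then row k A else 0).
  by exists E; split=> // j /Erow->; rewrite rowK.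
have AE : A = \sum_(k | k != i) E k.
  apply/eqP; rewrite -subr_eq0; apply/eqP/injW.
    by rewrite memvB // memv_suml // => k _; exact: (EE k).1.
  move=> j ji; rewrite raddfB raddf_sum /= (bigD1 j) //= (EE j).2 // eqxx.
  rewrite big1 ?addr0 ?subrr // => k /andP[_ kj].
  by rewrite (EE k).2 // eq_sym (negPf kj).
rewrite mulmx_sum_row (bigD1 i) //= mxE eqxx scale1r {1}AE raddf_sum /=.
rewrite -big_split big1 //= => k ki; rewrite mxE (negPf ki) scaleNr.
rewrite (cE k ki (E k) (EE k).1) => [|j ji jk].
  by rewrite (EE k).2 // eqxx subrr.
by rewrite (EE k).2 // (negPf jk).
Qed.

Lemma proper_row_space_normal (H : {vspace 'rV[F]_n}) : (\dim H < n)%N ->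
  exists2 v : 'cV[F]_n, v != 0 & forall a, a \in H -> a *m v = 0.
Proof.
move=> dimH; pose B := \matrix_(i < \dim H) (vbasis H)`_i.
have /rowV0Pn[w /sub_kermxP wB w0] : kermx B^T != 0.
  rewrite -mxrank_eq0 mxrank_ker subn_eq0 -ltnNge.
  by apply: leq_ltn_trans dimH; exact: rank_leq_col.
exists w^T; first by rewrite trmx_eq0.
move=> a /coord_vbasis->; rewrite mulmx_suml big1 // => i _.
rewrite -scalemxAl -[(vbasis H)`_i](rowK (fun i => (vbasis H)`_i)) -row_mul.
by rewrite -[B *m _]trmxK trmx_mul trmxK wB trmx0 row0 scaler0.
Qed.

Theorem singular_space_type W :
    poly_singular W -> (n * n.-1 <= \dim W)%N ->
  (exists2 u : 'rV[F]_n, u != 0 & forall A, A \in W -> u *m A = 0) \/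
  (exists2 v : 'cV[F]_n, v != 0 & forall A, A \in W -> A *m v = 0).
Proof.
move=> singW dimW.
have n_gt0 : (0 < n)%N.
  case: posnP => // n0; have /eqP : \det (1%:M : 'M[{poly F}]_n) = 0.
    apply: singW => d; rewrite (_ : map_mx _ _ = 0) ?mem0v //.
    by apply/matrixP=> i; have := ltn_ord i; rewrite {2}n0.
  by rewrite det1 oner_eq0.
have [[i injW]|[H [dimH HE]]] := row_layer_dichotomy 1%g singW dimW.
  by left; exact: row_type injW.
have layerW s i : (row_layer W s i <= rowlf i @: W)%VS by rewrite limgS ?capvSl.
have [/forallP rowsH|] := boolP [forall i, rowlf i @: W <= H]%VS.
  right; have [|v v0 Hv] := @proper_row_space_normal H.
    by rewrite dimH ltn_predL.
  exists v => // A AW; apply/row_matrixP=> i; rewrite row_mul row0 Hv //.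
  by move/subvP: (rowsH i); apply; rewrite -rowlfE memv_img.
rewrite negb_forall => /existsP[i /negP Hi]; left.
have last_lt : (n.-1 < n)%N by rewrite ltn_predL.
(* With row [i] in the last place, its layer is the space of all [i]-th rows of [W]. This contains
   the layer [H] of the first order, which has the same dimension, so it lies in [H] after all. *)
pose s := tperm i (Ordinal last_lt).
have [[k injW]|[H' [dimH' H'E]]] := row_layer_dichotomy s singW dimW.
  exact: row_type injW.
have HiE : (rowlf i @: W)%VS = H'.
  apply: subv_anti; rewrite -{2}(H'E i) layerW -(H'E i) andbT.
  apply: limgS; apply/subvP=> A AW; apply/mem_row_flag; split=> // j.
  by rewrite /s tpermL /= prednK // leqNgt ltn_ord.
case: Hi; rewrite HiE; suff -> : H' = H by [].
by apply/esym/eqP; rewrite eqEdim dimH dimH' leqnn andbT -HiE -(HE i).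
Qed.

End SingularSpaces.

(** * Syzygies of distinct variables *)

Section Koszul.
Variables (F : fieldType) (m r : nat) (v : 'I_r -> 'I_m).
Hypothesis v_inj : injective v.
Implicit Types (p : {mpoly F[m]}) (k : 'X_{1..m}).

Lemma mcoeffMXU p i k :
  (p * 'X_i)@_k = if (0 < k i)%N then p@_(k - U_(i))%MM else 0.
Proof.
case: posnP => [ki|ki]; last first.
  have {1}-> : k = (U_(i) + (k - U_(i)))%MM.
    by rewrite addmC submK // lep1mP -lt0n.
  by rewrite mcoeffMX.
rewrite {1}(mpolyE p) mulr_suml raddf_sum big1 //= => l _.
rewrite -scalerAl -mpolyXD mcoeffZ mcoeffX; case: eqP => [lk|_]; last by rewrite mulr0.
by move: ki; rewrite -lk mnmDE mnm1E eqxx addn1.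
Qed.

Definition quotient_part (j : 'I_r) p : {mpoly F[m]} :=
  \sum_(k <- msupp p | (0 < k (v j))%N && [forall l : 'I_r, (j < l)%N ==> (k (v l) == 0%N)])
     p@_k *: 'X_[k - U_(v j)].

Lemma mcoeff_quotient_part j p k :
  (quotient_part j p)@_k =
    if [forall l : 'I_r, (j < l)%N ==> (k (v l) == 0%N)] then p@_(k + U_(v j)) else 0.
Proof.
have U0 (l : 'I_r) : (j < l)%N -> (k + U_(v j))%MM (v l) = k (v l).
  move=> jl; rewrite mnmDE mnm1E (inj_eq v_inj).
  by case: eqP => [ji|]; rewrite ?addn0 //; move: jl; rewrite ji ltnn.
rewrite raddf_sum /=.
have [kj|kj] := boolP (k + U_(v j) \in msupp p)%MM; last first.
  rewrite (memN_msupp_eq0 kj) if_same big_seq_cond big1 // => l /andP[lp /andP[l0 _]].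
  rewrite mcoeffZ mcoeffX; case: eqP => [lk|]; last by rewrite mulr0.
  by move: kj; rewrite -lk submK ?lp // lep1mP -lt0n.
rewrite big_mkcond (bigD1_seq (k + U_(v j))%MM) ?msupp_uniq //= big1 => [|l lk].
  rewrite mnmDE mnm1E eqxx addn1 /= addr0 addmK mcoeffZ mcoeffX eqxx mulr1.
  congr (if _ then _ else _); apply: eq_forallb => l.
  by case: ltnP => //= jl; rewrite U0.
case: ifP => // /andP[l0 _]; rewrite mcoeffZ mcoeffX; case: eqP => [kE|]; last by rewrite mulr0.
by case/eqP: lk; rewrite -kE submK // lep1mP -lt0n.
Qed.

Lemma quotient_part_homog j d p :
  p \is d.-homog -> quotient_part j p \is (d.-1).-homog.
Proof.
move=> p_homog; rewrite /quotient_part big_seq_cond; apply: rpred_sum => k /andP[kp /andP[k0 _]].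
apply: dhomogZ; rewrite dhomogX; apply/eqP.
have Uk : (U_(v j) <= k)%MM by rewrite lep1mP -lt0n.
have := dhomog_mf p_homog kp; rewrite /= -{1}(submK Uk) mdegD mdeg1 addn1.
by move=> <-.
Qed.

(* The relation is read off monomial by monomial: [quotient_part j] keeps the
   monomials whose last variable among the [v l] is [v j], and divides by it. *)
Lemma koszul_exact d (p : 'I_r -> {mpoly F[m]}) :
    (forall i, p i \is d.-homog) -> \sum_i 'X_(v i) * p i = 0 ->
  exists q : 'M[{mpoly F[m]}]_r,
    [/\ forall i j, q i j \is (d.-1).-homog, forall i, q i i = 0,
        forall i j, q i j = - q j i
      & forall i, p i = \sum_(j | j != i) q i j * 'X_(v j)].
Proof.
move=> p_homog sum0.
(* Above the diagonal, [q i j] collects the monomials of [p i] whose last variable is ['X_(v j)];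
   the entries below are forced by alternation. *)
pose q : 'M[{mpoly F[m]}]_r := \matrix_(i, j)
  if (i < j)%N then quotient_part j (p i)
  else if (j < i)%N then - quotient_part i (p j) else 0.
exists q; split=> [i j|i|i j|i].
- rewrite mxE; case: ifP => _; first exact: quotient_part_homog.
  by case: ifP => _; rewrite ?rpredN ?rpred0 ?quotient_part_homog.
- by rewrite mxE ltnn.
- by rewrite !mxE; case: ltngtP; rewrite ?opprK ?oppr0.
apply/mpolyP=> k; rewrite raddf_sum /=.
have aboveB (j : 'I_r) : [forall l : 'I_r, (i < l)%N ==> (k (v l) == 0%N)] ->
    [forall l : 'I_r, (i < l)%N ==> ((k - U_(v j))%MM (v l) == 0%N)].
  move=> /forallP k_i; apply/forallP=> l; apply/implyP=> il.
  by have := k_i l; rewrite il mnmBE => /eqP->.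
(* If no variable after [v i] divides the monomial [k], only indices [j < i] contribute, and the
   claim is the given relation at the monomial [k + U_(v i)]. *)
have [k_i|] := boolP [forall l : 'I_r, (i < l)%N ==> (k (v l) == 0%N)].
  have := congr1 (mcoeff (k + U_(v i))) sum0.
  rewrite mcoeff0 raddf_sum (bigD1 i) //= mulrC mcoeffMXU mnmDE mnm1E eqxx addn1 /= addmK.
  move/eqP; rewrite addr_eq0 => /eqP->; rewrite -sumrN; apply: eq_bigr => j ji.
  rewrite mulrC !mcoeffMXU mnmDE mnm1E (inj_eq v_inj) eq_sym (negPf ji) addn0.
  case: posnP => [_|kj]; first by rewrite oppr0.
  have lt_ji : (j < i)%N.
    rewrite ltn_neqAle ji leqNgt; apply/negP=> ij.
    by move/forallP/(_ j): k_i; rewrite ij eqn0Ngt kj.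
  rewrite mxE ltnNge (ltnW lt_ji) lt_ji /= mcoeffN mcoeff_quotient_part aboveB //.
  congr (- (p j)@_ _); apply/mnmP=> l; rewrite !mnmDE !mnmBE !mnmDE.
  by rewrite addnBAC // mnm1E; case: eqP => // <-.
rewrite negb_forall => /existsP[l0]; rewrite negb_imply -lt0n => /andP[i_l0 k_l0].
(* Otherwise let [v t] be the last variable dividing [k]. The term [j = t] yields the whole
   coefficient of [p i]; in the others, [v t] still divides the monomial and the quotient parts for
   earlier indices vanish there. *)
have [t kt t_max] := @arg_maxnP _ l0 (fun l => (0 < k (v l))%N) (fun l => l) k_l0.
have it : (i < t)%N by apply: leq_trans i_l0 _; exact: t_max.
have ti : t != i by apply: contraTneq it => ->; rewrite ltnn.
rewrite (bigD1 t) //= mcoeffMXU kt mxE it mcoeff_quotient_part.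
rewrite ifT; last first.
  apply/forallP=> l; apply/implyP=> tl; rewrite mnmBE eqn0Ngt.
  by apply: contraTN tl => kl; rewrite -leqNgt; apply: t_max; apply: leq_trans kl (leq_subr _ _).
rewrite submK ?lep1mP -?lt0n // big1 ?addr0 // => j /andP[ji jt].
rewrite mcoeffMXU; case: posnP => // kj; rewrite mxE.
have jt' : (j < t)%N by rewrite ltn_neqAle jt; exact: t_max.
have ne_v a b : a != b -> (v a == v b) = false by rewrite (inj_eq v_inj) => /negPf.
have other (s : 'I_r) p' : (s < t)%N -> (quotient_part s p')@_(k - U_(v j)) = 0.
  move=> st; rewrite mcoeff_quotient_part ifF //; apply/negbTE.
  rewrite negb_forall; apply/existsP; exists t; rewrite st mnmBE mnm1E ne_v // subn0.
  by rewrite -lt0n.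
by do 2?[case: ifP => _]; rewrite ?mcoeffN ?mcoeff0 ?other ?oppr0.
Qed.

End Koszul.

(** * Linear substitutions and reductions *)

Section LinearSubstitution.
Variables (F : fieldType) (m : nat).
Implicit Types (A B : 'M[F]_m) (p : {mpoly F[m]}).

HB.instance Definition _ A :=
  GRing.RMorphism.copy (lin_subst A)
    (comp_mpoly [tuple \sum_(l < m) A k l *: 'X_l | k < m]).
HB.instance Definition _ A :=
  GRing.Linear.copy (lin_subst A)
    (comp_mpoly [tuple \sum_(l < m) A k l *: 'X_l | k < m]).

Lemma lin_substX A k : lin_subst A 'X_k = \sum_(l < m) A k l *: 'X_l.
Proof. by rewrite /lin_subst comp_mpolyXU -tnth_nth tnth_mktuple. Qed.

Lemma lin_subst_monomial A (k : 'X_{1..m}) :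
  lin_subst A 'X_[k] = \prod_i lin_subst A 'X_i ^+ k i.
Proof. by rewrite mpolyXE_id rmorph_prod; apply: eq_bigr => i _; rewrite rmorphXn. Qed.

Lemma lin_substE A p :
  lin_subst A p = \sum_(k <- msupp p) p@_k *: lin_subst A 'X_[k].
Proof.
rewrite {1}(mpolyE p) (raddf_sum (lin_subst A)) /=.
by apply: eq_bigr => k _; rewrite linearZ.
Qed.

Lemma lin_subst_homog A d p : p \is d.-homog -> lin_subst A p \is d.-homog.
Proof.
move=> p_homog; rewrite lin_substE big_seq.
apply: rpred_sum => k kp; apply: dhomogZ.
have <- : mdeg k = d := dhomog_mf p_homog kp.
rewrite lin_subst_monomial mdegE.
apply: (big_rec2 (fun e q => q \is e.-homog)) => [|i e q _ q_homog].
  exact: dhomog1.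
apply: dhomogM q_homog; rewrite -[X in X.-homog]mul1n; apply: dhomogMn.
rewrite lin_substX; apply: rpred_sum => l _; apply: dhomogZ.
by rewrite dhomogX; apply/eqP; exact: mdeg1.
Qed.

Lemma lin_subst_comp A B p : lin_subst B (lin_subst A p) = lin_subst (A *m B) p.
Proof.
rewrite [lin_subst A p]lin_substE [RHS]lin_substE (raddf_sum (lin_subst B)) /=.
apply: eq_bigr => k _; rewrite linearZ /=; congr (_ *: _).
rewrite !lin_subst_monomial rmorph_prod /=.
apply: eq_bigr => i _; rewrite rmorphXn /=; congr (_ ^+ _).
rewrite !lin_substX raddf_sum /=; under eq_bigr do rewrite linearZ /= lin_substX scaler_sumr.
rewrite exchange_big; apply: eq_bigr => l _; rewrite mxE scaler_suml.
by apply: eq_bigr => j _; rewrite scalerA.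
Qed.

Lemma lin_subst1 p : lin_subst 1%:M p = p.
Proof.
rewrite -[RHS]comp_mpoly_id; congr (_ \mPo _); apply: eq_mktuple => k.
rewrite (bigD1 k) //= mxE eqxx scale1r big1 ?addr0 // => l lk.
by rewrite mxE eq_sym (negPf lk) scale0r.
Qed.

Lemma linear_formE p : p \is 1.-homog -> p = \sum_k p@_U_(k) *: 'X_k.
Proof.
move=> p_homog; apply/mpolyP=> k; rewrite raddf_sum /=.
under eq_bigr do rewrite mcoeffZ mcoeffX.
have [/existsP[i /eqP->]|k1] := boolP [exists i, k == U_(i)%MM].
  rewrite (bigD1 i) //= eqxx mulr1 big1 ?addr0 // => j ji.
  by case: eqP => [/mnmP/(_ i)|]; rewrite ?mulr0 // !mnm1E eqxx (negPf ji).
rewrite (dhomog_nemf_coeff p_homog) ?mdeg_eq1 // big1 // => i _.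
case: eqP => [ki|]; last by rewrite mulr0.
by case/existsP: k1; exists i; rewrite ki.
Qed.

End LinearSubstitution.

(** * Reversible reduction steps *)

Section Steps.
Variables (F : fieldType) (m d : nat) (f : {mpoly F[m]}) (r : nat).
Implicit Types D E : slice_decomposition d f r.

Lemma sd_equiv_step D E : reduction_step D E -> reduction_step E D -> sd_equiv D E.
Proof. by move=> DE ED; split; exact: t_step. Qed.

Lemma sd_equiv_trans D E G : sd_equiv D E -> sd_equiv E G -> sd_equiv D G.
Proof.
by move=> [DE ED] [EG GE]; split; [exact: t_trans DE EG | exact: t_trans GE ED].
Qed.

Lemma sum_scalar_mx (V : lmodType F) (x : 'I_r -> V) i :
  \sum_j (1%:M : 'M[F]_r) i j *: x j = x i.
Proof.
rewrite (bigD1 i) //= mxE eqxx scale1r big1 ?addr0 // => j ji.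
by rewrite mxE eq_sym (negPf ji) scale0r.
Qed.

Lemma sd_equiv_refl D : sd_equiv D D.
Proof.
have DD : reduction_step D D.
  apply: Or31; exists 1%:M; split=> i; first by rewrite sum_scalar_mx.
  rewrite -[LHS](sum_scalar_mx _ i); apply: eq_bigr => j _.
  by rewrite -[in LHS](trmx1 F r) mxE.
exact: sd_equiv_step.
Qed.

(** The inverse substitution [B] fixes [f] as well, so it undoes the reduction by [A]. *)
Lemma symmetric_equiv D (A B : 'M[F]_m) :
    A *m B = 1%:M -> lin_subst A f = f ->
  exists2 E, sd_equiv D E & forall i, sd_lin E i = lin_subst A (sd_lin D i).
Proof.
move=> AB Af.
have Bf : lin_subst B f = f by rewrite -{1}Af lin_subst_comp AB lin_subst1.
have fE : f = \sum_i lin_subst A (sd_lin D i) * lin_subst A (sd_cof D i).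
  rewrite -{1}Af {1}(sd_sum D) (raddf_sum (lin_subst A)) /=.
  by apply: eq_bigr => i _; rewrite rmorphM.
pose E := SliceDecomposition (fun i => lin_subst_homog A (sd_lin_homog D i))
  (fun i => lin_subst_homog A (sd_cof_homog D i)) fE.
exists E => //; apply: sd_equiv_step; apply: Or33.
  by exists B; split=> // i; rewrite /= lin_subst_comp AB lin_subst1.
by exists A.
Qed.

(** Linear reduction along [c] prescribes the cofactors of [E], and reduction along [invmx c] leads
    back. *)
Lemma linear_equiv D (beta : 'I_r -> {mpoly F[m]}) (c : 'M[F]_r) :
    c \in unitmx -> (forall j, beta j \is 1.-homog) ->
    (forall i, sd_lin D i = \sum_j c i j *: beta j) ->
  exists2 E, sd_equiv D E & forall i, sd_lin E i = beta i.
Proof.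
move=> c_unit beta_homog linD.
pose h j := \sum_i c i j *: sd_cof D i.
have h_homog j : h j \is (d.-1).-homog.
  by apply: rpred_sum => i _; apply: dhomogZ; exact: sd_cof_homog.
have fE : f = \sum_j beta j * h j.
  rewrite {1}(sd_sum D); under eq_bigr do rewrite linD mulr_suml.
  rewrite exchange_big; apply: eq_bigr => j _; rewrite mulr_sumr.
  by apply: eq_bigr => i _; rewrite -scalerAl -scalerAr.
exists (SliceDecomposition beta_homog h_homog fE) => //.
have inv_sum (V : lmodType F) (b b' : 'M[F]_r) (x : 'I_r -> V) i : b *m b' = 1%:M ->
    \sum_j b i j *: (\sum_k b' j k *: x k) = x i.
  move=> bb'; under eq_bigr do rewrite scaler_sumr.
  rewrite exchange_big /= -[RHS]sum_scalar_mx -bb'; apply: eq_bigr => k _.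
  by rewrite mxE scaler_suml; apply: eq_bigr => j _; rewrite scalerA.
apply: sd_equiv_step; apply: Or31; last by exists c.
exists (invmx c); split=> [i|j] /=.
  by under eq_bigr do rewrite linD; rewrite inv_sum ?mulVmx.
have <- := @inv_sum _ (invmx c)^T c^T (sd_cof D) j _; last by rewrite -trmx_mul mulmxV ?trmx1.
apply: eq_bigr => i _; rewrite mxE; congr (_ *: _).
by apply: eq_bigr => k _; rewrite mxE.
Qed.

(** The differences of the cofactors form a syzygy of the variables. By [koszul_exact] it comes from
    an alternating [q]; [q] and [- q] give the two syzygy reductions. *)
Lemma variables_equiv D E (v : 'I_r -> 'I_m) :
    (1 < d)%N -> injective v ->
    (forall i, sd_lin D i = 'X_(v i)) -> (forall i, sd_lin E i = 'X_(v i)) ->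
  sd_equiv D E.
Proof.
move=> d_gt1 v_inj linD linE.
have /(koszul_exact v_inj)[|q [q_homog q0 q_alt qE]] :
    forall i, sd_cof D i - sd_cof E i \is (d.-1).-homog.
- by move=> i; rewrite rpredB ?sd_cof_homog.
- under eq_bigr do rewrite mulrBr -{1}linD -linE.
  by rewrite sumrB -!sd_sum subrr.
apply: sd_equiv_step; apply: Or32.
  exists (- q); split=> [i j|i|i j|i|i].
  - by rewrite mxE rpredN subn2; exact: q_homog.
  - by rewrite mxE q0 oppr0.
  - by rewrite !mxE q_alt.
  - by rewrite linD linE.
  rewrite -(subrK (sd_cof E i) (sd_cof D i)) qE addrC -sumrN; congr (_ + _).
  by apply: eq_bigr => j _; rewrite mxE mulNr opprK linE.
exists q; split=> [i j|//|//|i|i].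
- by rewrite subn2; exact: q_homog.
- by rewrite linD linE.
under eq_bigr do rewrite linD.
by rewrite -qE opprB addrCA subrr addr0.
Qed.

End Steps.

(** * Decompositions of the determinant *)

Section SliceRankDet.
Variables (F : fieldType) (n : nat).
Implicit Types (p : {mpoly F[n * n]}) (A : 'M[F]_n).

Definition eval_mx p A : F := p.@[mxvec A 0].

Lemma eval_mxE p A : p \is 1.-homog ->
  eval_mx p A = \sum_k p@_U_(k) * mxvec A 0 k.
Proof.
move=> p_homog; rewrite /eval_mx {1}(linear_formE p_homog) raddf_sum /=.
by apply: eq_bigr => k _; rewrite mevalZ mevalXU.
Qed.

Lemma eval_mx_delta p i j : p \is 1.-homog ->
  eval_mx p (delta_mx i j) = p@_U_(mxvec_index i j).
Proof.
move=> p_homog; rewrite eval_mxE // mxvec_delta (bigD1 (mxvec_index i j)) //=.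
rewrite mxE !eqxx mulr1 big1 ?addr0 // => k /negPf k_ij.
by rewrite mxE k_ij andbF mulr0.
Qed.

(** [lin_mx g] acts on row vectors and [lin_subst] on column vectors, hence the transpose. *)
Lemma eval_lin_subst (g : {linear 'M[F]_n -> 'M[F]_n}) p A :
  eval_mx (lin_subst (lin_mx g)^T p) A = eval_mx p (g A).
Proof.
rewrite /eval_mx /lin_subst comp_mpoly_meval; apply: meval_eq => k.
rewrite tnth_mktuple raddf_sum /= -mul_vec_lin mxE; apply: eq_bigr => l _.
by rewrite mevalZ mevalXU mulrC [in LHS]mxE.
Qed.

Lemma sum_mxvec_index (V : nmodType) (h : 'I_(n * n) -> V) :
  \sum_k h k = \sum_i \sum_j h (mxvec_index i j).
Proof.
rewrite pair_bigA /= (reindex (uncurry (@mxvec_index n n))) /=.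
  by apply: eq_bigr => -[].
by case: (curry_mxvec_bij n n) => h' hK h'K; exists h' => k _; [exact: hK | exact: h'K].
Qed.

Lemma mxvec_index_injr (i : 'I_n) : injective (@mxvec_index n n i).
Proof.
case: (curry_mxvec_bij n n) => h hK _ j k jk.
by have := congr1 h jk; rewrite [LHS](hK (i, j)) // [RHS](hK (i, k)) // => -[].
Qed.

Lemma lin_subst_generic (g : {linear 'M[F]_n -> 'M[F]_n}) i j :
  lin_subst (lin_mx g)^T (generic_mx F n i j) =
    \sum_k \sum_l g (delta_mx k l) i j *: generic_mx F n k l.
Proof.
rewrite mxE lin_substX sum_mxvec_index; apply: eq_bigr => k _; apply: eq_bigr => l _.
by rewrite !mxE /= vec_mx_delta mxvecE.
Qed.

Lemma lin_subst_det (M : 'M[F]_(n * n)) :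
  lin_subst M (det_form F n) = \det (map_mx (lin_subst M) (generic_mx F n)).
Proof. by rewrite det_map_mx. Qed.

Lemma lin_subst_mulmx_det (Q : 'M[F]_n) : \det Q = 1 ->
  lin_subst (lin_mx (mulmx Q))^T (det_form F n) = det_form F n.
Proof.
move=> detQ; rewrite lin_subst_det.
have deltaE k l i j : (Q *m delta_mx k l) i j = if j == l then Q i k else 0.
  rewrite mxE (bigD1 k) //= mxE eqxx /= big1 ?addr0 => [|a /negPf ak].
    by case: eqP; rewrite ?mulr1 ?mulr0.
  by rewrite mxE ak mulr0.
have -> : map_mx (lin_subst (lin_mx (mulmx Q))^T) (generic_mx F n) =
    map_mx (@mpolyC _ F) Q *m generic_mx F n.
  apply/matrixP=> i j; rewrite mxE lin_subst_generic [RHS]mxE; apply: eq_bigr => k _.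
  rewrite (bigD1 j) //= big1 ?addr0 => [|l lj].
    by rewrite deltaE eqxx [map_mx _ _ _ _]mxE mul_mpolyC.
  by rewrite deltaE eq_sym (negPf lj) scale0r.
by rewrite det_mulmx det_map_mx detQ rmorph1 mul1r.
Qed.

Lemma lin_subst_trmx_det :
  lin_subst (lin_mx trmx)^T (det_form F n) = det_form F n.
Proof.
rewrite lin_subst_det -[RHS]det_tr; congr (\det _); apply/matrixP=> i j.
rewrite mxE lin_subst_generic (bigD1 j) //= (bigD1 i) //= trmx_delta mxE !eqxx scale1r.
rewrite !big1 ?addr0 => [|l li|k kj]; first by rewrite !mxE.
  by rewrite big1 // => k _; rewrite trmx_delta mxE [j == l]eq_sym (negPf li) andbF scale0r.
by rewrite trmx_delta mxE eq_sym (negPf kj) scale0r.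
Qed.

Lemma lin_mx_inverse (g h : {linear 'M[F]_n -> 'M[F]_n}) : cancel h g ->
  (lin_mx g)^T *m (lin_mx h)^T = 1%:M.
Proof.
move=> gh; rewrite -trmx_mul -[RHS]trmx1; congr _^T; apply/row_matrixP=> k.
by rewrite !rowE mulmxA !mul_rV_lin /= mxvecK gh vec_mxK mulmx1.
Qed.

(** * The common zeros of the linear forms *)

Section Decomposition.
Variable r : nat.
Implicit Types D E : slice_decomposition n (det_form F n) r.

Definition zero_space D : {vspace 'M[F]_n} :=
  lker (linfun (mulmxr (\matrix_(k, i) (sd_lin D i)@_U_(k)) \o mxvec)
          : 'Hom('M[F]_n, 'rV[F]_r)).

Lemma mem_zero_space D A :
  reflect (forall i, eval_mx (sd_lin D i) A = 0) (A \in zero_space D).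
Proof.
rewrite memv_ker lfunE /=.
have eval_row i : (mxvec A *m \matrix_(k, i) (sd_lin D i)@_U_(k)) 0 i =
    eval_mx (sd_lin D i) A.
  rewrite eval_mxE ?sd_lin_homog // mxE; apply: eq_bigr => k _.
  by rewrite mxE mulrC.
apply: (iffP eqP) => [/rowP A0 i|A0]; first by rewrite -eval_row A0 mxE.
by apply/rowP=> i; rewrite eval_row A0 mxE.
Qed.

Lemma dim_zero_space D : (n * n - r <= \dim (zero_space D))%N.
Proof.
rewrite leq_subLR -[(n * n)%N]/(dim 'M[F]_n) -dimvf /zero_space.
set g := (X in lker X); rewrite -(limg_ker_dim g) capfv addnC leq_add2r.
by rewrite (leq_trans (dimvS (subvf _))) // dimvf /dim /= mul1n.
Qed.

(** Evaluate the decomposition at [A]. The coefficients of the value of a linear form are its values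
    at the coefficient matrices of [A], which are all 0. *)
Lemma poly_singular_zero_space D : poly_singular (zero_space D).
Proof.
move=> A AW.
pose ev : {rmorphism {mpoly F[n * n]} -> {poly F}} := mmap (@polyC F) (mxvec A 0).
have ev_lin i : ev (sd_lin D i) = 0.
  apply/polyP=> e; rewrite coef0 -[RHS](elimT (mem_zero_space D _) (AW e) i).
  rewrite eval_mxE ?sd_lin_homog // [in LHS](linear_formE (sd_lin_homog D i)).
  rewrite /ev raddf_sum coef_sum /=; apply: eq_bigr => k _.
  by rewrite mmapZ mmapX mmap1U coefCM; case/mxvec_indexP: k => a b; rewrite !mxvecE mxE.
have -> : A = map_mx ev (generic_mx F n).
  by apply/matrixP=> i j; rewrite !mxE /ev /= mmapX mmap1U mxvecE.
have := congr1 ev (sd_sum D); rewrite /det_form -det_map_mx => ->.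
by rewrite raddf_sum big1 // => i _; rewrite /= rmorphM /= ev_lin mul0r.
Qed.

Lemma symmetric_equiv_mx D (g h : {linear 'M[F]_n -> 'M[F]_n}) :
    cancel h g -> lin_subst (lin_mx g)^T (det_form F n) = det_form F n ->
  exists2 E, sd_equiv D E & forall A, (A \in zero_space E) = (g A \in zero_space D).
Proof.
move=> gh g_det; have [E DE linE] := symmetric_equiv D (lin_mx_inverse gh) g_det.
exists E => // A; apply/mem_zero_space/mem_zero_space => A0 i.
  by rewrite -eval_lin_subst -linE.
by rewrite linE eval_lin_subst.
Qed.

Lemma row_annihilator_dim (u : 'rV[F]_n) : u != 0 ->
  (\dim (lker (linfun (mulmx u) : 'Hom('M[F]_n, 'rV[F]_n))) + n = n * n)%N.
Proof.
move=> u0; set g : 'Hom(_, _) := linfun _.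
have := limg_ker_dim g fullv; rewrite capfv.
have -> : (g @: fullv)%VS = fullv.
  apply/vspaceP=> a; rewrite memvf; apply/memv_imgP.
  have /rV0Pn[i ui] := u0.
  exists (delta_mx i 0 *m ((u 0 i)^-1 *: a)); rewrite ?memvf // lfunE /= mulmxA -colE.
  rewrite -scalemxAr [col i u]mx11_scalar mxE mul_scalar_mx scalerA mulVf ?scale1r //.
by rewrite !dimvf /dim /= mul1n.
Qed.

Lemma row_type_equiv D : (r <= n)%N -> exists E, exists u : 'rV[F]_n,
  [/\ sd_equiv D E, u != 0 & forall A, A \in zero_space E -> u *m A = 0].
Proof.
move=> r_n.
have dimW : (n * n.-1 <= \dim (zero_space D))%N.
  apply: leq_trans (dim_zero_space D); case: (n) r_n => [|k] //; rewrite mulnS; nia.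
have [[u u0 uW]|[v v0 vW]] := singular_space_type (@poly_singular_zero_space D) dimW.
  exists D, u; split=> //; exact: sd_equiv_refl.
have [E DE EW] := symmetric_equiv_mx D (@trmxK _ n n) lin_subst_trmx_det.
exists E, v^T; split=> // [|A]; first by rewrite trmx_eq0.
rewrite EW => /vW Av; by rewrite -[A]trmxK -trmx_mul Av trmx0.
Qed.

(** For [r < n] the zero space would have codimension below [n], yet lie in an annihilator of
    codimension exactly [n]. *)
Lemma slice_rank_det_ge D : (n <= r)%N.
Proof.
rewrite leqNgt; apply/negP=> r_n.
have [E [u [_ u0 uW]]] := row_type_equiv D (ltnW r_n).
have := row_annihilator_dim u0; have := dim_zero_space E.
have : (zero_space E <= lker (linfun (mulmx u) : 'Hom('M[F]_n, 'rV[F]_n)))%VS.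
  by apply/subvP=> A /uW uA; rewrite memv_ker lfunE /= uA.
move/dimvS; move: (\dim _) (\dim _) => x y; nia.
Qed.

End Decomposition.

(** Complete [u], as row [i], to an invertible matrix and rescale some other row to make the
    determinant 1. *)
Lemma special_row_moving (u : 'rV[F]_n) (i : 'I_n) : (1 < n)%N -> u != 0 ->
  exists2 Q : 'M[F]_n, \det Q = 1 & u *m Q = delta_mx 0 i.
Proof.
move=> n_gt1 u0.
have rank1 (w : 'rV[F]_n) : w != 0 -> \rank w = 1%N by rewrite rank_rV => ->.
(* The matrix with all rows equal to [u] sends the [i]-th basis row to [u]; [complete_unitmx]
   replaces it by an invertible [P] doing the same. *)
have [|P P_unit] := @complete_unitmx _ _ _ (delta_mx 0 i : 'rV[F]_n) (\matrix_(j < n) u).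
  rewrite -rowE rowK !rank1 //; apply/rV0Pn; exists i; rewrite mxE !eqxx; exact: oner_neq0.
rewrite -rowE rowK => uP.
have [j ji] : exists j : 'I_n, j != i.
  have [i0|i0] := eqVneq i (Ordinal (ltnW n_gt1)).
    by exists (Ordinal n_gt1); rewrite i0.
  by exists (Ordinal (ltnW n_gt1)); rewrite eq_sym.
pose d : 'rV[F]_n := \row_k if k == j then (\det P)^-1 else 1.
have detR : \det (diag_mx d *m P) = 1.
  rewrite det_mulmx det_diag (bigD1 j) //= mxE eqxx big1 => [|k kj].
    by rewrite mulr1 mulVf // -unitfE -unitmxE.
  by rewrite mxE (negPf kj).
exists (invmx (diag_mx d *m P)); first by rewrite det_inv detR invr1.
suff -> : u = delta_mx 0 i *m (diag_mx d *m P) by rewrite mulmxK // unitmxE detR unitr1.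
by rewrite -rowE row_mul row_diag_mx mxE eq_sym (negPf ji) scale1r -uP.
Qed.

Lemma slice_decomposition_laplace (hn : (1 < n)%N) (i : 'I_n)
    (D : slice_decomposition n (det_form F n) n) :
  sd_equiv D (laplace_decomposition F i).
Proof.
have [E [u [DE u0 uW]]] := row_type_equiv D (leqnn n).
have [Q detQ uQ] := special_row_moving i hn u0.
have Q_unit : Q \in unitmx by rewrite unitmxE detQ unitr1.
have [G EG GW] := symmetric_equiv_mx E (mulKVmx Q_unit) (lin_subst_mulmx_det detQ).
(* Codimension at most [n] turns the inclusion in the annihilator of [u] into an equality. *)
have {uW} EW A : (A \in zero_space E) = (u *m A == 0).
  pose Z := lker (linfun (mulmx u) : 'Hom('M[F]_n, 'rV[F]_n)).
  suff -> : zero_space E = Z by rewrite memv_ker lfunE.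
  apply/eqP; rewrite eqEdim; apply/andP; split.
    by apply/subvP=> B /uW uB; rewrite memv_ker lfunE /= uB.
  by apply: leq_trans (dim_zero_space E); rewrite -(row_annihilator_dim u0) addnK.
have {}GW A : (A \in zero_space G) = (row i A == 0).
  by rewrite GW EW mulmxA uQ -rowE.
pose c : 'M[F]_n := \matrix_(a, j) (sd_lin G a)@_U_(mxvec_index i j).
(* A matrix unit outside row [i] is a common zero, so only the variables of row [i] occur. *)
have linG a : sd_lin G a = \sum_j c a j *: generic_mx F n i j.
  rewrite (linear_formE (sd_lin_homog G a)) sum_mxvec_index (bigD1 i) //=.
  rewrite [X in _ + X]big1 ?addr0 => [|k ki].
    by apply: eq_bigr => j _; rewrite !mxE.
  apply: big1 => j _; rewrite -eval_mx_delta ?sd_lin_homog //.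
  suff /mem_zero_space-> : delta_mx k j \in zero_space G by rewrite scale0r.
  by rewrite GW rowE mul_delta_mx_cond [i == k]eq_sym (negPf ki).
(* A vector [w] killed by the transpose of [c], placed in row [i] of a zero matrix, is a common zero
   of the forms, so its row [i] vanishes. *)
have c_unit : c \in unitmx.
  rewrite unitmxE unitfE -det_tr; apply/det0P=> -[w w0 wc].
  have : delta_mx i 0 *m w \in zero_space G.
    apply/mem_zero_space=> a; rewrite linG /eval_mx raddf_sum.
    transitivity ((w *m c^T) 0 a); last by rewrite wc mxE.
    rewrite [RHS]mxE; apply: eq_bigr => j _; rewrite /= mevalZ.
    by rewrite !mxE mevalXU mxvecE !mxE big_ord1 mxE !eqxx mul1r mulrC.
  by rewrite GW row_mul rowE mul_delta_mx [delta_mx _ _]mx11_scalar mxE eqxx mul1mx (negPf w0).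
have [H GH linH] := linear_equiv c_unit (generic_mx_homog F i) linG.
apply: sd_equiv_trans DE _; apply: sd_equiv_trans EG _; apply: sd_equiv_trans GH _.
apply: (@variables_equiv _ _ _ _ _ _ _ (mxvec_index i)) => // [|j|j].
- exact: mxvec_index_injr.
- by rewrite linH mxE.
- by rewrite /= mxE.
Qed.

End SliceRankDet.

Theorem theorem2p6 (F : fieldType) (n : nat) (hn : (2 <= n)%N) :
  is_slice_rank n (det_form F n) n /\
  (forall D : slice_decomposition n (det_form F n) n,
     sd_equiv D (laplace_decomposition F (Ordinal (ltnW hn : (0 < n)%N)))).
Proof.
split=> [|D]; last exact: slice_decomposition_laplace.
split=> [|s [D]]; last exact: slice_rank_det_ge D.
by constructor; exact: laplace_decomposition (Ordinal (ltnW hn)).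
Qed.
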